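(* Let $\mathcal{X}$ be a complex Banach space, let $A\in B(\mathcal{X})$ be a bounded operator with spectrum $\sigma(A)$, and let $\varepsilon>0$. Put $K=\sigma(A)$, $K_\delta=\{z\in\mathbb{C}:\operatorname{dist}(z,K)\le\delta\}$ for $\delta>0$, and $\Gamma_\varepsilon=K_\varepsilon\setminus\operatorname{int}K_{\varepsilon/2}$. Then there exists a rational function $r=p/q$ without poles in $\sigma(A)$ such that $\deg q<\deg p$, $p$ has simple roots, $\|r(A)\|<1$, and $|r(z)|>1$ for all $z\in\Gamma_\varepsilon$.
   Context: $B(\mathcal{X})$ denotes the bounded linear operators on $\mathcal{X}$. A rational function is written $r=p/q$ with complex polynomials $p,q$ having no common roots; at a pole of $r$ one sets $|r(z)|=\infty$. If $r$ has no poles in $\sigma(A)$, then $r(A)=p(A)q(A)^{-1}$ is a well-defined bounded operator. *)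

(* Defs.v *)
From HB Require Import structures.
From mathcomp Require Import all_boot all_order all_algebra.
From mathcomp Require Import all_classical all_reals all_analysis.
From mathcomp Require Export complex.
Set Implicit Arguments.
Unset Strict Implicit.
Unset Printing Implicit Defensive.
Import Order.TTheory GRing.Theory Num.Theory.
Import numFieldNormedType.Exports.
Local Open Scope classical_set_scope.
Local Open Scope ring_scope.

Section Operators.
Context {R : realType} {X : completeNormedModType R[i]}.
Implicit Types (T S A : X -> X) (p q : {poly R[i]}) (z : R[i]).

Definition bounded_operator T : Prop :=
  linear T /\ exists M : R[i], forall x, `|T x| <= M * `|x|.

(* Norms of elements of X are nonnegative real elements of R[i], hence the Re;
   the supremum in \bar R is finite exactly when T is bounded. *)
Definition opnorm T : \bar R :=
  ereal_sup [set (complex.Re `|T x|)%:E | x in [set x | `|x| <= 1]].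

Definition inverse_operator T S : Prop :=
  [/\ bounded_operator S, cancel T S & cancel S T].

Definition spectrum A : set R[i] :=
  [set z | ~ exists S, inverse_operator (fun x => A x - z *: x) S].

Definition polyop A p : X -> X :=
  fun x => \sum_(i < size p) p`_i *: iter i A x.

(* rA = p(A) q(A)^-1; asserts in particular that q(A) is invertible in B(X).
   Such an rA is unique. *)
Definition is_ratop A p q (rA : X -> X) : Prop :=
  exists2 S, inverse_operator (polyop A q) S & rA = polyop A p \o S.

End Operators.

Section Plane.
Context {R : realType}.
Implicit Types (K : set R[i]) (p q : {poly R[i]}) (z : R[i]) (d : R).

(* The distance to the empty set is +oo. *)
Definition dist_to K z : \bar R := ereal_inf [set (complex.Re `|z - w|)%:E | w in K].

(* Typed as a set of R[i]^o, which carries the topology of the modulus. *)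
Definition thickening K d : set R[i]^o := [set z | (dist_to K z <= d%:E)%E].

Definition Gamma K d : set R[i] :=
  thickening K d `\` (thickening K (d / 2))°.

(* r = p/q in lowest terms. *)
Definition reduced_fraction p q : Prop :=
  q != 0 /\ forall z, ~ (root p z /\ root q z).

Definition abs_rat p q z : \bar R :=
  if root q z then +oo%E else (complex.Re `|p.[z] / q.[z]|)%:E.

Definition simple_roots p : Prop := forall z, root p z -> mup z p = 1%N.

End Plane.

(* Main.v *)
Require Import Defs.
From HB Require Import structures.
From mathcomp Require Import all_boot all_order all_algebra.
From mathcomp Require Import all_classical all_reals all_analysis.
From mathcomp Require Import complex.
From mathcomp Require Import ring lra zify.
Set Implicit Arguments.
Unset Strict Implicit.
Unset Printing Implicit Defensive.
Import Order.TTheory GRing.Theory Num.Theory.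
Import numFieldNormedType.Exports.
Local Open Scope classical_set_scope.
Local Open Scope ring_scope.

(** The rational function is a discretised Cauchy integral. Let K be the
    spectrum of A. The function that is a nonzero constant near Gamma and 0
    near K is the integral of 1 / (w - z) along a contour that surrounds Gamma
    and leaves K outside. Its value at A is 0, because the resolvent is
    holomorphic inside the contour, and its Riemann sums are rational functions
    of z. So a fine enough Riemann sum G is small at A and of constant order on
    Gamma.

    The two halves of this argument become finite computations if the interior
    of the contour is tiled by small squares. Tile a large square with cells of
    side 2s, keep the cells whose centre c is at distance at least eps / 4 from
    K, and let G be the sum over these cells of
<<
      sum_(k < 4) i^k s / (c + i^k s - z) = 4 s^4 / (s^4 - (c - z)^4),
>>
    the midpoint rule along the boundary of the cell, up to a constant factor
    ([cell_sum], [partial_fractions]). The right side is of order s^4, also for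
    z = A, because the resolvent is uniformly bounded on the centres that were
    kept ([uniform_resolvent], [cell_ratio]). There are of order s^-2 cells, so
    the norm of G(A) is of order s^2. The left side telescopes: for z in Gamma
    all cells of a box around z are kept, adjacent cells cancel along their
    common edge, and the terms on the boundary of the box all have positive real
    part, with a sum that is bounded below independently of s ([box_sum_ge]);
    the cells outside the box again contribute only order s^2
    ([grid_sum_ge]). Hence G(A) has norm at most 1 / 8 and |G| is at least 1
    on Gamma, except at poles ([separating_reduced_fraction]).

    The function sought is r = 2 G + delta z + u, where delta and u are small.
    The linear term raises the degree of the numerator above that of the
    denominator. The constant u makes the roots of the numerator simple: for
    numerators p1 + u q, only finitely many u allow a double root, as the
    Wronskian of p1 and q vanishes there ([generic_shift_simple]).

    Operator norms of fractions are handled through the inequalities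
    |p(A) x| <= b |q(A) x| ([ratio_le]); the inverse of q(A) is taken once, at
    the end ([polyop_invertible]). *)

(** * Real-valued norms *)

Section RealNorm.
Context {R : realType}.

(** Norms over [R[i]] are complex numbers that happen to be real; taking the
    real part once and for all moves every estimate into the ordered field
    [R], where linear arithmetic applies. *)
Definition rnorm {V : normedZmodType R[i]} (x : V) : R := complex.Re `|x|.

Section Zmod.
Variable V : normedZmodType R[i].
Implicit Types x y : V.

Lemma rnormE x : `|x| = (rnorm x)%:C%C.
Proof. by rewrite /rnorm RRe_real // normr_real. Qed.

Lemma rnorm_ge0 x : 0 <= rnorm x.
Proof. by rewrite -ler0c -rnormE normr_ge0. Qed.

Lemma rnorm0 : rnorm (0 : V) = 0.
Proof. by rewrite /rnorm normr0. Qed.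

Lemma rnorm_eq0 x : (rnorm x == 0) = (x == 0).
Proof. by rewrite -[RHS]normr_eq0 rnormE -(inj_eq (@complexI R)). Qed.

Lemma rnorm_gt0 x : (0 < rnorm x) = (x != 0).
Proof. by rewrite lt_def rnorm_ge0 andbT rnorm_eq0. Qed.

Lemma rnormD x y : rnorm (x + y) <= rnorm x + rnorm y.
Proof. by rewrite -lecR rmorphD /= -!rnormE ler_normD. Qed.

Lemma rnormN x : rnorm (- x) = rnorm x.
Proof. by rewrite /rnorm normrN. Qed.

Lemma rnormB x y : rnorm (x - y) = rnorm (y - x).
Proof. by rewrite /rnorm distrC. Qed.

Lemma rnorm_geB x y : rnorm x - rnorm y <= rnorm (x + y).
Proof.
by rewrite lerBlDr; have := rnormD (x + y) (- y); rewrite rnormN addrK.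
Qed.

Lemma rnorm_sum (I : Type) (r : seq I) (F : I -> V) :
  rnorm (\sum_(i <- r) F i) <= \sum_(i <- r) rnorm (F i).
Proof.
elim/big_rec2: _ => [|i y1 y2 _ le12]; first by rewrite rnorm0.
by rewrite (le_trans (rnormD _ _)) // lerD2l.
Qed.
End Zmod.

Lemma rnormZ (V : normedModType R[i]) (a : R[i]) (x : V) :
  rnorm (a *: x) = rnorm a * rnorm x.
Proof. by apply: complexI; rewrite rmorphM /= -!rnormE normrZ. Qed.

Implicit Types a b z w : R[i].

Lemma rnormM a b : rnorm (a * b) = rnorm a * rnorm b.
Proof. by apply: complexI; rewrite rmorphM /= -!rnormE normrM. Qed.

Lemma rnorm1 : rnorm (1 : R[i]) = 1.
Proof. by rewrite /rnorm normr1. Qed.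

Lemma rnorm_nat n : rnorm (n%:R : R[i]) = n%:R.
Proof. by rewrite /rnorm normr_nat -(rmorph_nat (real_complex R)). Qed.

Lemma rnormX a n : rnorm (a ^+ n) = rnorm a ^+ n.
Proof.
by elim: n => [|n IHn]; rewrite ?expr0 ?rnorm1 // !exprS rnormM IHn.
Qed.

Lemma rnormV a : rnorm a^-1 = (rnorm a)^-1.
Proof. by apply: complexI; rewrite fmorphV /= -!rnormE normfV. Qed.

Lemma rnormC (t : R) : rnorm t%:C%C = `|t|.
Proof.
by rewrite /rnorm normc_def /= expr0n /= addr0 sqrtr_sqr.
Qed.

Lemma rnorm_Re z : `|complex.Re z| <= rnorm z.
Proof. by rewrite -lecR -rnormE normc_ge_Re. Qed.

Lemma rnorm_Im z : `|complex.Im z| <= rnorm z.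
Proof.
have := rnorm_Re (z * 'i%C); rewrite ReiNIm normrN rnormM.
by rewrite /rnorm [`|'i%C|]normc_def /= expr0n add0r expr1n sqrtr1 mulr1.
Qed.

Lemma rnorm_le_ReIm z : rnorm z <= `|complex.Re z| + `|complex.Im z|.
Proof.
rewrite {1}(complexE z) (le_trans (rnormD _ _)) // rnormM !rnormC.
by rewrite /rnorm [`|'i%C|]normc_def /= expr0n add0r expr1n sqrtr1 mul1r.
Qed.
End RealNorm.

(** * Polynomials of an operator *)

Section FunctionalCalculus.
Context {R : realType} {X : completeNormedModType R[i]}.
Variable A : X -> X.
Hypothesis A_lin : linear A.
Implicit Types (p q : {poly R[i]}) (x : X) (z w : R[i]).

Lemma linear_zero (f : X -> X) : linear f -> f 0 = 0.
Proof.
move=> fl; have := fl (-1) 0 0.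
by rewrite scaler0 addr0 scaleN1r addNr.
Qed.

Lemma linear_add (f : X -> X) x y : linear f -> f (x + y) = f x + f y.
Proof. by move=> fl; have := fl 1 x y; rewrite !scale1r. Qed.

Lemma linear_scale (f : X -> X) a x : linear f -> f (a *: x) = a *: f x.
Proof.
by move=> fl; have := fl a x 0; rewrite !addr0 (linear_zero fl) addr0.
Qed.

Lemma polyop_widen p n x : (size p <= n)%N ->
  polyop A p x = \sum_(i < n) p`_i *: iter i A x.
Proof.
move=> le_pn; rewrite /polyop (big_ord_widen n (fun i => p`_i *: iter i A x)) //.
rewrite big_mkcond; apply: eq_bigr => i _ /=.
by case: ltnP => // ge_ip; rewrite nth_default // scale0r.
Qed.

Lemma polyopD p q x : polyop A (p + q) x = polyop A p x + polyop A q x.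
Proof.
set n := maxn (size p) (size q).
rewrite !(@polyop_widen _ n) ?size_polyD ?leq_maxl ?leq_maxr //.
by rewrite -big_split; apply: eq_bigr => i _ /=; rewrite coefD scalerDl.
Qed.

Lemma polyopZ a p x : polyop A (a *: p) x = a *: polyop A p x.
Proof.
rewrite (@polyop_widen _ (size p)) ?size_scale_leq // scaler_sumr.
by apply: eq_bigr => i _; rewrite coefZ scalerA.
Qed.

Lemma polyopC a x : polyop A a%:P x = a *: x.
Proof.
by rewrite (@polyop_widen _ 1) ?size_polyC ?leq_b1 // big_ord1 coefC.
Qed.

Lemma polyopMX p x : polyop A (p * 'X) x = polyop A p (A x).
Proof.
rewrite (@polyop_widen _ (size p).+1); last first.
  by rewrite (leq_trans (size_polyMleq _ _)) // size_polyX addn2.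
rewrite big_ord_recl coefMX /= scale0r add0r.
by apply: eq_bigr => i _; rewrite coefMX /= -iterSr.
Qed.

Lemma polyopX x : polyop A 'X x = A x.
Proof. by rewrite -['X]mul1r polyopMX polyopC scale1r. Qed.

(** This makes the calculus multiplicative, so that the operators [p(A)]
    commute and a common factor of two polynomials can be split off. *)
Lemma polyopM p q x : polyop A (p * q) x = polyop A p (polyop A q x).
Proof.
elim/poly_ind: p x => [|p c IHp] x.
  by rewrite mul0r !polyopC !scale0r.
have -> : (p * 'X + c%:P) * q = p * q * 'X + c *: q.
  by rewrite mulrDl mul_polyC -!mulrA (mulrC 'X).
rewrite !polyopD polyopMX IHp polyopZ polyopMX polyopC; congr (polyop A p _ + _).
elim/poly_ind: q x {IHp} => [|q d IHq] x.
  by rewrite !polyopC !scale0r (linear_zero A_lin).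
rewrite !polyopD !polyopMX IHq !polyopC.
by rewrite (linear_add _ _ A_lin) (linear_scale _ _ A_lin).
Qed.

Lemma polyopMC p q x : polyop A p (polyop A q x) = polyop A q (polyop A p x).
Proof. by rewrite -!polyopM mulrC. Qed.

Hypothesis A_bounded : exists M : R[i], forall x, `|A x| <= M * `|x|.

Lemma bounded_rnorm : exists2 M : R, 0 < M & forall x, rnorm (A x) <= M * rnorm x.
Proof.
have [M0 hM0] := A_bounded; exists (`|complex.Re M0| + 1).
  by rewrite ltr_wpDl.
move=> x; have := hM0 x; rewrite !rnormE lecE => /andP[_].
move=> /le_trans; apply.
have -> : complex.Re (M0 * (rnorm x)%:C%C) = complex.Re M0 * rnorm x.
  by case: (M0) => a b /=; rewrite mulr0 subr0.
by rewrite ler_wpM2r ?rnorm_ge0 // ler_wpDr // ler_norm.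
Qed.
End FunctionalCalculus.

(** * Inverses, and the Neumann series *)

Section Inverses.
Context {R : realType} {X : completeNormedModType R[i]}.
Implicit Types (f g S T : X -> X) (x y : X) (z w : R[i]) (p q : {poly R[i]}).

Lemma bounded_operator_rnorm f (M : R) : linear f ->
  (forall x, rnorm (f x) <= M * rnorm x) -> bounded_operator f.
Proof.
move=> fl fM; split=> //; exists M%:C%C => x.
by rewrite !rnormE -rmorphM lecR.
Qed.

(** A lower bound [rnorm x <= B * rnorm (f x)] gives injectivity and, for the
    inverse, the operator bound [B]. *)
Lemma inverse_operator_intro f (B : R) : linear f ->
  (forall x, rnorm x <= B * rnorm (f x)) -> (forall y, exists x, f x = y) ->
  exists S, inverse_operator f S.
Proof.
move=> fl fB /choice[S fS]; exists S.
have f_inj x y : f x = f y -> x = y.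
  move=> fxy; apply/eqP; rewrite -subr_eq0 -rnorm_eq0 -scaleN1r addrC eq_le.
  rewrite rnorm_ge0 andbT (le_trans (fB _)) // fl fxy scaleN1r addNr rnorm0.
  by rewrite mulr0.
split=> // [|x]; last by apply: f_inj; rewrite fS.
apply: (@bounded_operator_rnorm _ B) => [a x y|x].
  by apply: f_inj; rewrite fl !fS.
by rewrite -[in leRHS](fS x) fB.
Qed.

Lemma inverse_operator_rnorm f S : inverse_operator f S ->
  exists2 B : R, 0 < B & forall x, rnorm x <= B * rnorm (f x).
Proof.
move=> [[Sl Sb] fK _]; have [B B0 SB] := bounded_rnorm Sb.
by exists B => // x; rewrite -[in leLHS](fK x) SB.
Qed.

Lemma inverse_operator_comp f g S T :
  inverse_operator f S -> inverse_operator g T ->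
  inverse_operator (f \o g) (T \o S).
Proof.
move=> [[Sl Sb] fK Sf] [[Tl Tb] gK Tg]; split; last 2 first.
- exact: can_comp.
- exact: can_comp.
have [B B0 SB] := bounded_rnorm Sb; have [C C0 TC] := bounded_rnorm Tb.
apply: (@bounded_operator_rnorm _ (C * B)) => [a x y|x] /=.
  by rewrite Sl Tl.
by rewrite (le_trans (TC _)) // -mulrA ler_wpM2l ?SB // ltW.
Qed.

(** The solution is the Neumann series of [T], whose terms are dominated by a
    geometric series. *)
Lemma contraction_solvable T (t : R) : linear T -> 0 <= t < 1 ->
  (forall x, rnorm (T x) <= t * rnorm x) -> forall y, exists x, x = T x + y.
Proof.
move=> Tl /andP[t0 t1] Tt y.
pose u n := iter n T y.
have uS n : u n.+1 = T (u n) by [].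
have u_le n : rnorm (u n) <= rnorm y * t ^+ n.
  elim: n => [|n IHn]; first by rewrite expr0 mulr1.
  by rewrite uS (le_trans (Tt _)) // exprS mulrCA ler_wpM2l.
have cu : cvgn (series u).
  apply/cauchy_cvgP/cauchy_seriesP => e e0.
  have [e' e'E] : exists e' : R, e = e'%:C%C.
    by exists (complex.Re e); rewrite RRe_real // gtr0_real.
  rewrite {}e'E -[0]/(0%:C%C) ltcR in e0 *.
  have : cvgn (series (geometric (rnorm y) t)).
    by apply: is_cvg_geometric_series; rewrite ger0_norm.
  move=> /cauchy_cvgP/cauchy_seriesP/(_ e' e0).
  apply: filterS => -[n m] /= /(le_lt_trans (ler_norm _)) le_e.
  rewrite rnormE ltcR (le_lt_trans _ le_e) // (le_trans (rnorm_sum _ _)) //.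
  by apply: ler_sum => k _; rewrite /geometric /= u_le.
pose x := limn (series u); exists x.
have u_x (e : R) : 0 < e -> \forall n \near \oo, rnorm (x - series u n) < e.
  move=> e0; have e0' : 0 < e%:C%C by rewrite -[0]/(0%:C%C) ltcR.
  move/cvgrPdist_lt : cu => /(_ _ e0'); apply: filterS => n.
  by rewrite rnormE ltcR.
have SuS n : series u n.+1 = T (series u n) + y.
  rewrite /series /=; elim: n => [|n IHn].
    by rewrite big_nat1 big_geq // (linear_zero Tl) add0r.
  rewrite [LHS]big_nat_recr //= [in RHS]big_nat_recr //= IHn.
  by rewrite (linear_add _ _ Tl) addrAC.
apply/eqP; rewrite -subr_eq0 -rnorm_eq0 eq_le rnorm_ge0 andbT.
apply/ler_addgt0Pl => e e0; rewrite addr0.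
have e20 : 0 < e / 2 by rewrite divr_gt0.
near \oo => n.
(* As [T (series u n) + y = series u n.+1], the defect of [x] is controlled by
   the tails at [n] and [n.+1]. *)
have -> : x - (T x + y) = (x - series u n.+1) + T ((-1) *: x + series u n).
  rewrite Tl SuS scaleN1r [T (series u n) + y]addrC !opprD !addrA.
  by rewrite addrAC (addrAC _ (- T (series u n))) subrK.
rewrite (le_trans (rnormD _ _)) // (splitr e) lerD //.
  apply/ltW; near: n; have [N _ uN] := u_x _ e20.
  by exists N => // k /= Nk; apply: uN => /=; exact: leqW.
rewrite (le_trans (Tt _)) // scaleN1r addrC rnormB.
rewrite (@le_trans _ _ (1 * rnorm (x - series u n))) ?ler_wpM2r ?rnorm_ge0 1?ltW //.
by rewrite mul1r; near: n; exact: u_x.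
Unshelve. all: by end_near. Qed.

End Inverses.

(** * The spectrum and bounds for the resolvent *)

Section Spectrum.
Context {R : realType} {X : completeNormedModType R[i]}.
Variable A : X -> X.
Hypothesis A_bounded : bounded_operator A.
Implicit Types (x y : X) (z w : R[i]) (p q : {poly R[i]}).

Let A_lin : linear A := A_bounded.1.

Lemma shift_linear z : linear (fun x => A x - z *: x).
Proof.
move=> a x y; rewrite A_lin scalerBr scalerDr !scalerA (mulrC z).
by rewrite opprD addrACA.
Qed.

Lemma polyop_shift z : polyop A ('X - z%:P) = fun x => A x - z *: x.
Proof.
by apply: funext => x; rewrite -polyCN polyopD polyopX polyopC scaleNr.
Qed.

(** For [rnorm z] above the norm of [A], the equation [A x - z *: x = y] is the
    fixed point equation of the contraction [z^-1 *: A], shifted by a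
    constant. *)
Lemma spectrum_bounded (M : R) : 0 < M ->
  (forall x, rnorm (A x) <= M * rnorm x) ->
  forall z, spectrum A z -> rnorm z <= M.
Proof.
move=> M0 AM z Kz; rewrite leNgt; apply: contra_notN Kz => Mz.
have z0 : z != 0 by rewrite -rnorm_gt0 (lt_trans M0).
have zn0 := lt_trans M0 Mz.
apply: (@inverse_operator_intro _ _ _ (rnorm z - M)^-1 (shift_linear z)) => [x|y].
  rewrite mulrC ler_pdivlMr ?subr_gt0 // mulrBr rnormB.
  rewrite (le_trans _ (rnorm_geB _ _)) // rnormN rnormZ mulrC.
  by rewrite lerD2l lerN2 mulrC.
have [||x|x xE] := @contraction_solvable _ _ (fun x => z^-1 *: A x) (M / rnorm z)
   _ _ _ (- (z^-1 *: y)).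
- by move=> a u v; rewrite A_lin scalerDr !scalerA mulrC.
- by rewrite divr_ge0 ?(ltW M0) ?rnorm_ge0 //= ltr_pdivrMr ?mul1r.
- by rewrite rnormZ rnormV mulrAC [leRHS]mulrC ler_wpM2l ?invr_ge0 ?rnorm_ge0.
exists x; rewrite [in z *: x]xE scalerBr !scalerA mulfV // !scale1r.
by rewrite opprB addrC subrK.
Qed.

Lemma resolvent_rnorm z : ~ spectrum A z ->
  exists2 B : R, 0 < B & forall x, rnorm x <= B * rnorm (A x - z *: x).
Proof.
by move=> /contrapT[S /inverse_operator_rnorm].
Qed.

(** The polynomial splits into linear factors, each of which gives an
    invertible operator. *)
Lemma polyop_invertible q : q != 0 ->
  (forall z, spectrum A z -> ~~ root q z) ->
  exists S, inverse_operator (polyop A q) S.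
Proof.
have [r ->] := closed_field_poly_normal q.
have [->|a0 _] := eqVneq (lead_coef q) 0; first by rewrite scale0r eqxx.
move: (lead_coef q) a0 => a a0.
elim: r => [|w r IHr] qK.
  exists (fun x => a^-1 *: x); split.
  - apply: (@bounded_operator_rnorm _ _ _ (rnorm a^-1)) => [b x y|x].
      by rewrite scalerDr !scalerA mulrC.
    by rewrite rnormZ.
  - by move=> x; rewrite big_nil alg_polyC polyopC scalerA mulVf ?scale1r.
  - by move=> x; rewrite big_nil alg_polyC polyopC scalerA mulfV ?scale1r.
have [|S] := IHr.
  move=> z /qK; apply: contra; rewrite big_cons scalerAr rootM => ->.
  by rewrite orbT.
have : ~ spectrum A w.
  by move=> /qK; rewrite big_cons scalerAr rootM root_XsubC eqxx.
move=> /contrapT[T wT] qS; exists (S \o T).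
have -> : polyop A (a *: \prod_(z <- w :: r) ('X - z%:P)) =
  (fun x => A x - w *: x) \o polyop A (a *: \prod_(z <- r) ('X - z%:P)).
  by apply: funext => x /=; rewrite big_cons scalerAr polyopM // polyop_shift.
exact: inverse_operator_comp.
Qed.

(** The estimate is local: around a point of the spectrum there are no
    admissible [z], and around a point [z] of the resolvent set the lower bound
    of [A - z] survives small perturbations with a doubled constant.
    Compactness of the square then makes [B] uniform. *)
Lemma uniform_resolvent (W d : R) : 0 < d ->
  exists2 B : R, 0 < B & forall z,
    `|complex.Re z| <= W -> `|complex.Im z| <= W ->
    (forall w, spectrum A w -> d <= rnorm (z - w)) ->
    forall x, rnorm x <= B * rnorm (A x - z *: x).
Proof.
move=> d0.
pose P (B : R) (c : R * R) :=
  (forall w, spectrum A w -> d <= rnorm ((c.1 +i* c.2)%C - w)) ->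
    forall x, rnorm x <= B * rnorm (A x - (c.1 +i* c.2)%C *: x).
have cpt : compact (`[- W, W]%classic `*` `[- W, W]%classic : set (R * R)).
  by apply: compact_setX; exact: segment_compact.
move/compact_near_coveringP : cpt => /(_ R +oo P _) cpt.
have close (c : R * R) (e : R) : 0 < e -> \forall c' \near c,
    rnorm ((c'.1 +i* c'.2)%C - (c.1 +i* c.2)%C) <= e.
  move=> e0; exists (ball c.1 (e/2), ball c.2 (e/2)).
    by split; apply: nbhsx_ballx; rewrite divr_gt0.
  move=> [a b] /= [ca cb]; rewrite (le_trans (rnorm_le_ReIm _)) // (splitr e).
  move: ca cb; rewrite /ball /= => ca cb.
  by rewrite lerD // distrC ltW.
have : \forall B \near +oo, `[- W, W]%classic `*` `[- W, W]%classic `<=` P B.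
  apply: cpt => c _; set z := (c.1 +i* c.2)%C.
  have [Kz|/resolvent_rnorm[B B0 zB]] := pselect (spectrum A z).
    have d20 : 0 < d / 2 by rewrite divr_gt0.
    near=> c' B => zc'; have : rnorm ((c'.1 +i* c'.2)%C - z) <= d / 2 by near: c'; exact: close.
    move=> /(le_trans (zc' _ Kz)); rewrite leNgt => /negP[].
    by rewrite ltr_pdivrMr // ltr_pMr ?ltr1n.
  have B20 : 0 < (2 * B)^-1 by rewrite invr_gt0 mulr_gt0.
  near=> c' C => _ x.
  have : rnorm ((c'.1 +i* c'.2)%C - z) <= (2 * B)^-1 by near: c'; exact: close.
  set z' := (c'.1 +i* c'.2)%C => zz'.
  have BC : 2 * B <= C by near: C; apply: nbhs_pinfty_ge; exact: num_real.
  rewrite (@le_trans _ _ (2 * B * rnorm (A x - z' *: x))) //; last first.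
    by rewrite ler_wpM2r ?rnorm_ge0.
  have : rnorm (A x - z *: x) <= rnorm (A x - z' *: x) + (2 * B)^-1 * rnorm x.
    have -> : A x - z *: x = (A x - z' *: x) + (z' - z) *: x.
      by rewrite scalerBl addrA subrK.
    by rewrite (le_trans (rnormD _ _)) // lerD2l rnormZ ler_wpM2r ?rnorm_ge0.
  move=> /(ler_wpM2l (ltW B0)) /(le_trans (zB x)).
  have -> : (2 * B)^-1 = B^-1 / 2 by rewrite invfM mulrC.
  rewrite mulrDr !mulrA divff ?gt_eqF // mul1r.
  by have := rnorm_ge0 x; lra.
move=> /pinfty_ex_gt0[B B0 BP]; exists B => // -[a b] /=.
rewrite !ler_norml => aW bW; apply: (BP (a, b)); split=> /=.
  by rewrite in_itv.
by rewrite in_itv.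
Unshelve. all: by end_near. Qed.
End Spectrum.

(** * Midpoint sums around square cells *)

Section Cell.
Context {R : realType}.
Implicit Types (s L p q x y : R) (c z : R[i]) (j k m n : nat).

(** Consider the square cell with centre [c] and side [2 * s], and approximate
    the integral of [1 / (w - z)] along its boundary by the values at the four
    midpoints [w = c + i^k s], with the weights [i^k s] proportional to the
    oriented edges. The sum of these four terms has the closed form below, see
    [partial_fractions]. The closed form shows that it is of order [s^4] away
    from the cell, that is, much smaller than the area of the cell; the four
    terms show that adjacent cells cancel along their common edge. *)
Definition cell_sum s c z : R[i] :=
  4 * s%:C%C ^+ 4 / (s%:C%C ^+ 4 - (c - z) ^+ 4).

(** The real part of [1 / (p + i q)]. *)
Definition re_inv p q : R := p / (p ^+ 2 + q ^+ 2).

Lemma Re_div s p q : complex.Re (s%:C%C / (p +i* q)%C) = s * re_inv p q.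
Proof. by rewrite /re_inv /=; ring. Qed.

Lemma Re_idiv s p q : complex.Re ('i%C * s%:C%C / (p +i* q)%C) = s * re_inv q p.
Proof. by rewrite /re_inv /= [q ^+ 2 + _]addrC; ring. Qed.

Lemma re_invN p q : re_inv (- p) q = - re_inv p q.
Proof. by rewrite /re_inv sqrrN mulNr. Qed.

Lemma partial_fractions (F : fieldType) (i S v : F) : i ^+ 2 = -1 ->
  S ^+ 4 - v ^+ 4 != 0 ->
  4 * S ^+ 4 / (S ^+ 4 - v ^+ 4) = S / (v + S) - S / (v - S)
    + (i * S / (v + i * S) - i * S / (v - i * S)).
Proof.
move=> i2 nz.
have vi : (v + i * S) * (v - i * S) = v ^+ 2 + S ^+ 2.
  have -> : (v + i * S) * (v - i * S) = v ^+ 2 - i ^+ 2 * S ^+ 2 by ring.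
  by rewrite i2; ring.
have f4 : S ^+ 4 - v ^+ 4 = - ((v + S) * (v - S) * ((v + i * S) * (v - i * S))).
  by rewrite vi; ring.
have v1 : v + S != 0 by apply: contra_neq nz => E; rewrite f4 E !mul0r oppr0.
have v2 : v - S != 0 by apply: contra_neq nz => E; rewrite f4 E mulr0 !mul0r oppr0.
have v3 : v + i * S != 0 by apply: contra_neq nz => E; rewrite f4 E mul0r mulr0 oppr0.
have v4 : v - i * S != 0 by apply: contra_neq nz => E; rewrite f4 E !mulr0 oppr0.
have -> : S / (v + S) - S / (v - S) = - (2 * S ^+ 2) / ((v + S) * (v - S)).
  by field; rewrite v1 v2.
have -> : i * S / (v + i * S) - i * S / (v - i * S) =
    2 * S ^+ 2 / ((v + i * S) * (v - i * S)).
  have -> : 2 * S ^+ 2 = - (2 * i ^+ 2 * S ^+ 2) by rewrite i2; ring.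
  by field; rewrite v3 v4.
rewrite f4.
have -> : 4 * S ^+ 4 = 2 * S ^+ 2 * ((v + i * S) * (v - i * S) - (v + S) * (v - S)).
  by rewrite vi; ring.
by field; rewrite v1 v2 v3 v4 /= -f4.
Qed.

Lemma Re_cell_sum s c z : s%:C%C ^+ 4 - (c - z) ^+ 4 != 0 ->
  let p := complex.Re (c - z) in let q := complex.Im (c - z) in
  complex.Re (cell_sum s c z) =
    s * (re_inv (p + s) q - re_inv (p - s) q)
    + s * (re_inv (q + s) p - re_inv (q - s) p).
Proof.
rewrite /cell_sum => /(partial_fractions (sqr_i R)) ->; case: (c - z) => p q.
have -> : (p +i* q)%C + s%:C%C = ((p + s) +i* q)%C by simpc.
have -> : (p +i* q)%C - s%:C%C = ((p - s) +i* q)%C by simpc.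
have -> : (p +i* q)%C + 'i%C * s%:C%C = (p +i* (q + s))%C by simpc.
have -> : (p +i* q)%C - 'i%C * s%:C%C = (p +i* (q - s))%C by simpc.
have ReD (u v : R[i]) : complex.Re (u + v) = complex.Re u + complex.Re v.
  by case: u v => [? ?] [].
have ReN (u : R[i]) : complex.Re (- u) = - complex.Re u by case: u.
by rewrite !(ReD, ReN) !Re_div !Re_idiv !mulrBr.
Qed.

(** On the edge of a box of half-width about [L] the outward component of
    [1 / w] is bounded below by a multiple of [1 / L]; the range of [p] allows
    for a centre that is off by a third of [L]. *)
Lemma re_inv_ge L p q : 0 < L -> 2 / 3 * L <= p <= 4 / 3 * L -> `|q| <= L ->
  2 / (5 * L) <= re_inv p q.
Proof.
move=> L0 /andP[p1 p2]; rewrite ler_norml => /andP[q1 q2].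
have p0 : 0 < p by lra.
rewrite /re_inv ler_pdivrMr ?mulr_gt0 // mulrAC ler_pdivlMr; last first.
  by rewrite ltr_wpDr ?sqr_ge0 ?exprn_gt0.
have q2L : q ^+ 2 <= L ^+ 2 by nra.
nra.
Qed.

Lemma box_telescope s x m (g : R -> R) :
  \sum_(0 <= a < m) (g (x + 2 * s * a%:R + s) - g (x + 2 * s * a%:R - s)) =
  g (x + 2 * s * m%:R - s) - g (x - s).
Proof.
have := telescope_sumr (fun a => g (x + 2 * s * a%:R - s)) (leq0n m).
rewrite /= mulr0 addr0 => <-; apply: eq_bigr => a _.
by congr (g _ - _); rewrite -natr1; ring.
Qed.

(** Summing over a square box of [(2 * m).+1 ^ 2] cells around the origin, the
    terms of shared edges cancel and the boundary of the box remains. Each of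
    its four sides carries [(2 * m).+1] terms, each at least [2 / 5 * s / L] by
    [re_inv_ge], so each side contributes at least [2 / 5]: a bound that does
    not depend on the mesh [s]. *)
Lemma box_sum_ge s x y m (L := s * (2 * m).+1%:R) : 0 < s -> (0 < m)%N ->
  `|x + 2 * s * m%:R| <= s -> `|y + 2 * s * m%:R| <= s ->
  8 / 5 <= \sum_(0 <= a < (2 * m).+1) \sum_(0 <= b < (2 * m).+1)
    (let p := x + 2 * s * a%:R in let q := y + 2 * s * b%:R in
     s * (re_inv (p + s) q - re_inv (p - s) q)
     + s * (re_inv (q + s) p - re_inv (q - s) p)).
Proof.
move=> s0 m0 xs ys.
have m1 : 1 <= m%:R :> R by rewrite ler1n.
have LE : L = 2 * s * m%:R + s by rewrite /L -natr1 natrM; ring.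
have L0 : 0 < L by rewrite /L mulr_gt0 // ltr0Sn.
have sL : 3 * s <= L by rewrite LE; nra.
have edge (x' y' : R) b : (b < (2 * m).+1)%N ->
    `|x' + 2 * s * m%:R| <= s -> `|y' + 2 * s * m%:R| <= s ->
    4 / (5 * (2 * m).+1%:R) <= \sum_(0 <= a < (2 * m).+1)
      s * (re_inv (x' + 2 * s * a%:R + s) (y' + 2 * s * b%:R)
           - re_inv (x' + 2 * s * a%:R - s) (y' + 2 * s * b%:R)).
  move=> bm; rewrite !ler_norml => /andP[x1 x2] /andP[y1 y2].
  rewrite -mulr_sumr (@box_telescope s x' _ (fun t => re_inv t _)).
  have -> : x' - s = - (s - x') by ring.
  rewrite re_invN opprK.
  have b0 : 0 <= b%:R :> R by [].
  have bm' : b%:R <= 2 * m%:R :> R by rewrite -natrM ler_nat -ltnS.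
  have yb : `|y' + 2 * s * b%:R| <= L by rewrite ler_norml LE; apply/andP; split; nra.
  have -> : 4 / (5 * (2 * m).+1%:R) = s * (2 / (5 * L) + 2 / (5 * L)).
    have sn0 : s != 0 by rewrite gt_eqF.
    have : (2 * m).+1%:R != 0 :> R by rewrite pnatr_eq0.
    by rewrite /L; move: ((2 * m).+1%:R) => M M0; field; rewrite sn0 M0.
  have ME : (2 * m).+1%:R = 2 * m%:R + 1 :> R by rewrite -natr1 natrM.
  by rewrite ler_pM2l // lerD //; apply: re_inv_ge => //; rewrite ?ME;
     apply/andP; split; lra.
have -> : 8 / 5 = (\sum_(0 <= b < (2 * m).+1) 4 / (5 * (2 * m).+1%:R)) +
   (\sum_(0 <= b < (2 * m).+1) 4 / (5 * (2 * m).+1%:R)) :> R.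
  rewrite big_const_nat subn0 iter_addr_0 -[_ *+ (2 * m).+1]mulr_natr.
  have : (2 * m).+1%:R != 0 :> R by rewrite pnatr_eq0.
  by move: ((2 * m).+1%:R) => M M0; field.
have -> : forall F G : nat -> nat -> R,
    \sum_(0 <= a < (2 * m).+1) \sum_(0 <= b < (2 * m).+1) (F a b + G a b) =
    \sum_(0 <= b < (2 * m).+1) \sum_(0 <= a < (2 * m).+1) F a b +
    \sum_(0 <= a < (2 * m).+1) \sum_(0 <= b < (2 * m).+1) G a b.
  move=> F G; rewrite [X in _ = X + _]exchange_big -big_split.
  by apply: eq_bigr => a _; rewrite big_split.
by rewrite lerD //; apply: ler_sum_nat => b /andP[_ bm]; apply: edge.
Qed.
End Cell.

(** * Sums over the cells of a grid *)

Section Grid.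
Context {R : realType}.
Implicit Types (s x y : R) (c z : R[i]) (j k m n N : nat).

Lemma natr_odd n : (2 * n).+1%:R = 2 * n%:R + 1 :> R.
Proof. by rewrite -natr1 natrM. Qed.

Definition grid_point s N j k : R[i] :=
  ((2 * s * (j%:R - N%:R)) +i* (2 * s * (k%:R - N%:R)))%C.

(** The centres of the cells that tile the square of half-width
    [s * (2 * N).+1] around the origin. *)
Definition grid s N : seq R[i] :=
  [seq grid_point s N j k | j <- iota 0 (2 * N).+1, k <- iota 0 (2 * N).+1].

Lemma size_grid s N : size (grid s N) = ((2 * N).+1 ^ 2)%N.
Proof. by rewrite size_allpairs !size_iota. Qed.

Lemma big_grid s N (D : pred R[i]) (F : R[i] -> R[i]) :
  \sum_(c <- grid s N | D c) F c = \sum_(0 <= j < (2 * N).+1)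
    \sum_(0 <= k < (2 * N).+1)
      if D (grid_point s N j k) then F (grid_point s N j k) else 0.
Proof.
by rewrite big_mkcond /grid big_allpairs_dep /index_iota subn0.
Qed.

Lemma grid_abs_le s N c : 0 <= s -> c \in grid s N ->
  `|complex.Re c| <= s * (2 * N).+1%:R /\ `|complex.Im c| <= s * (2 * N).+1%:R.
Proof.
move=> s0 /allpairsP[[j k] []]; rewrite !mem_iota !add0n => /andP[_ jN] /andP[_ kN] -> /=.
have bound i : (i < (2 * N).+1)%N -> `|2 * s * (i%:R - N%:R)| <= s * (2 * N).+1%:R.
  rewrite ltnS => iN'; have iN : i%:R <= 2 * N%:R :> R by rewrite -natrM ler_nat.
  have i0 : 0 <= i%:R :> R by [].
  by rewrite natr_odd ler_norml; apply/andP; split; nra.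
by split; exact: bound.
Qed.

(** In one coordinate: the index [j] of the first cell of a window of
    [(2 * m).+1] consecutive cells whose middle cell, of index [j + m], is a
    cell containing [x]. *)
Lemma grid_index s x m N : 0 < s -> (m <= N)%N ->
  `|x| <= 2 * s * (N%:R - m%:R) ->
  exists2 j, (j + (2 * m).+1 <= (2 * N).+1)%N &
    `|2 * s * (j%:R - N%:R) - x + 2 * s * m%:R| <= s.
Proof.
move=> s0 mN; rewrite ler_norml => /andP[x1 x2].
pose t := x / (2 * s) + N%:R - m%:R.
have xE : x = (t + m%:R - N%:R) * (2 * s).
  by rewrite /t; field; rewrite gt_eqF.
have t0 : 0 <= t by nra.
have t2 : t <= 2 * (N%:R - m%:R) by nra.
have /truncn_itv/andP[j1 j2] : 0 <= t + 1 / 2 by lra.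
exists (Num.truncn (t + 1 / 2)).
  set j := Num.truncn _ in j1 *.
  rewrite addnS ltnS leqNgt; apply/negP => jN.
  have : 2 * N%:R + 1 <= j%:R + 2 * m%:R :> R by rewrite -!natrM natr1 -natrD ler_nat.
  by lra.
move: j1 j2; set j := Num.truncn _; rewrite -[j.+1%:R]natr1 => j1 j2.
by rewrite ler_norml; apply/andP; split; nra.
Qed.

Lemma outside_far s x j1 j m N : 0 < s ->
  `|2 * s * (j1%:R - N%:R) - x + 2 * s * m%:R| <= s ->
  ~~ ((j1 <= j) && (j < j1 + (2 * m).+1))%N ->
  s * (2 * m).+1%:R <= `|2 * s * (j%:R - N%:R) - x|.
Proof.
move=> s0; rewrite ler_norml => /andP[c1 c2].
rewrite negb_and -ltnNge -leqNgt ler_normr => /orP[].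
  rewrite natr_odd => jj'; apply/orP; right.
  have jj : j%:R + 1 <= j1%:R :> R by rewrite natr1 ler_nat.
  by nra.
rewrite natr_odd => jj'; apply/orP; left.
have jj : j1%:R + (2 * m%:R + 1) <= j%:R :> R by rewrite -natrM natr1 -natrD ler_nat.
by nra.
Qed.

Lemma inside_near s x j1 j m N : 0 < s ->
  `|2 * s * (j1%:R - N%:R) - x + 2 * s * m%:R| <= s ->
  (j1 <= j)%N -> (j < j1 + (2 * m).+1)%N ->
  `|2 * s * (j%:R - N%:R) - x| <= s * (2 * m).+1%:R.
Proof.
move=> s0; rewrite !ler_norml => /andP[c1 c2].
rewrite natr_odd addnS ltnS => j1j' jj'.
have j1j : j1%:R <= j%:R :> R by rewrite ler_nat.
have jj : j%:R <= j1%:R + 2 * m%:R :> R by rewrite -natrM -natrD ler_nat.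
by apply/andP; split; nra.
Qed.

Lemma cell_sum_far s L c z : 0 < s -> 3 * s <= L -> L <= rnorm (c - z) ->
  rnorm (cell_sum s c z) <= 8 * s ^+ 4 / L ^+ 4.
Proof.
move=> s0 sL Lc.
have L0 : 0 < L by lra.
have s4 : s ^+ 4 <= L ^+ 4 / 2.
  have : (3 * s) ^+ 4 <= L ^+ 4 by rewrite lerXn2r // nnegrE; lra.
  have : 0 < s ^+ 4 by rewrite exprn_gt0.
  by rewrite exprMn; lra.
have L4 : 0 < L ^+ 4 by rewrite exprn_gt0.
have den : L ^+ 4 / 2 <= rnorm (s%:C%C ^+ 4 - (c - z) ^+ 4).
  rewrite rnormB (le_trans _ (rnorm_geB _ _)) // rnormN !rnormX rnormC.
  have : L ^+ 4 <= rnorm (c - z) ^+ 4 by rewrite lerXn2r // nnegrE ?rnorm_ge0 // ltW.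
  by rewrite ger0_norm; lra.
rewrite /cell_sum rnormM rnormV rnormM rnormX rnormC.
rewrite (rnorm_nat 4).
rewrite gtr0_norm // ler_pdivrMr; last by rewrite (lt_le_trans _ den) // divr_gt0.
have -> : 4 * s ^+ 4 = 8 * s ^+ 4 / L ^+ 4 * (L ^+ 4 / 2).
  by field; rewrite gt_eqF.
by rewrite ler_wpM2l // ltW // divr_gt0 // mulr_gt0 // exprn_gt0.
Qed.

Lemma sum_window (V : zmodType) n j1 M (F : nat -> V) : (j1 + M <= n)%N ->
  \sum_(0 <= j < n) (if (j1 <= j)%N && (j < j1 + M)%N then F j else 0) =
  \sum_(0 <= a < M) F (j1 + a)%N.
Proof.
move=> jn.
rewrite (@big_cat_nat _ _ _ j1) //=; last by rewrite (leq_trans _ jn) ?leq_addr.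
rewrite (@big_cat_nat _ _ _ (j1 + M) j1) //=; last by rewrite leq_addr.
rewrite [X in X + _]big1_seq ?add0r; last first.
  by move=> j; rewrite mem_index_iota /= => jj; rewrite leqNgt jj.
rewrite [X in _ + X]big1_seq ?addr0; last first.
  by move=> j; rewrite mem_index_iota /= => /andP[jj _]; rewrite ltnNge jj andbF.
rewrite -{1}(add0n j1) big_addn addKn; apply: eq_big_nat => a /andP[_ aM].
by rewrite leq_addl [(a + j1)%N]addnC ltn_add2l aM.
Qed.

(** Let [D] select cells that include a box of half-width [L] around [z]. By
    [box_sum_ge] the cells in the box contribute real part at least [8 / 5].
    The centre of any other cell is at distance at least [L] from [z], so it
    contributes at most [8 * s ^+ 4 / L ^+ 4]; there are [(W / s) ^+ 2] cells in
    all, and the last hypothesis bounds their joint contribution by [3 / 5],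
    which leaves 1. *)
Lemma grid_sum_ge s m N (D : pred R[i]) z
    (L := s * (2 * m).+1%:R) (W := s * (2 * N).+1%:R) :
  0 < s -> (0 < m)%N -> (m <= N)%N ->
  `|complex.Re z| <= W - L -> `|complex.Im z| <= W - L ->
  (forall c, `|complex.Re (c - z)| <= L -> `|complex.Im (c - z)| <= L -> D c) ->
  (forall c, c \in grid s N -> D c -> s%:C%C ^+ 4 - (c - z) ^+ 4 != 0) ->
  W ^+ 2 * (8 * s ^+ 2) <= 3 / 5 * L ^+ 4 ->
  1 <= rnorm (\sum_(c <- grid s N | D c) cell_sum s c z).
Proof.
move=> s0 m0 mN; have m1 : 1 <= m%:R :> R by rewrite ler1n.
have -> : W - L = 2 * s * (N%:R - m%:R) by rewrite /W /L !natr_odd; ring.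
move=> /(grid_index s0 mN)[j1 j1N j1x] /(grid_index s0 mN)[k1 k1N k1y] zD nz small.
have L0 : 0 < L by rewrite mulr_gt0 // ltr0n.
have sL : 3 * s <= L by rewrite /L natr_odd; nra.
rewrite big_grid.
pose box j k := ((j1 <= j) && (j < j1 + (2 * m).+1) &&
  ((k1 <= k) && (k < k1 + (2 * m).+1)))%N.
pose P := grid_point s N.
have Re_P j k : complex.Re (P j k - z) = 2 * s * (j%:R - N%:R) - complex.Re z.
  by case: (z).
have Im_P j k : complex.Im (P j k - z) = 2 * s * (k%:R - N%:R) - complex.Im z.
  by case: (z).
have boxD j k : box j k -> D (P j k).
  move=> /andP[/andP[? ?] /andP[? ?]]; apply: zD.
    by rewrite Re_P (inside_near s0 j1x).
  by rewrite Im_P (inside_near s0 k1y).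
have P_grid j k : (j < (2 * N).+1)%N -> (k < (2 * N).+1)%N -> P j k \in grid s N.
  by move=> jN kN; apply/allpairsP; exists (j, k); rewrite !mem_iota.
pose G j k := if box j k then cell_sum s (P j k) z else 0.
pose H j k := if D (P j k) && ~~ box j k then cell_sum s (P j k) z else 0.
have -> : \sum_(0 <= j < (2 * N).+1) \sum_(0 <= k < (2 * N).+1)
    (if D (P j k) then cell_sum s (P j k) z else 0) =
  \sum_(0 <= j < (2 * N).+1) \sum_(0 <= k < (2 * N).+1) G j k +
  \sum_(0 <= j < (2 * N).+1) \sum_(0 <= k < (2 * N).+1) H j k.
  rewrite -big_split; apply: eq_bigr => j _; rewrite -big_split.
  apply: eq_bigr => k _; rewrite /G /H /=.
  have := @boxD j k; case: (box j k) => [->//|_] /=; first by rewrite addr0.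
  by rewrite andbT add0r.
have H_le : rnorm (\sum_(0 <= j < (2 * N).+1) \sum_(0 <= k < (2 * N).+1) H j k)
    <= 3 / 5.
  pose e := 8 * s ^+ 4 / L ^+ 4.
  have e0 : 0 <= e by rewrite ltW // divr_gt0 ?mulr_gt0 ?exprn_gt0.
  rewrite (@le_trans _ _ (\sum_(0 <= j < (2 * N).+1) \sum_(0 <= k < (2 * N).+1) e)) //.
    rewrite (le_trans (rnorm_sum _ _)) //; apply: ler_sum => j _.
    rewrite (le_trans (rnorm_sum _ _)) //; apply: ler_sum => k _.
    rewrite /H; case: ifP => [/andP[_]|_]; last by rewrite rnorm0.
    rewrite negb_and => far; apply: cell_sum_far => //.
    case/orP: far => far.
      by rewrite (le_trans _ (rnorm_Re _)) // Re_P (outside_far _ j1x).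
    by rewrite (le_trans _ (rnorm_Im _)) // Im_P (outside_far _ k1y).
  rewrite !big_const_nat !subn0 !iter_addr_0 -[e *+ _]mulr_natr -[_ *+ _]mulr_natr.
  have -> : e * (2 * N).+1%:R * (2 * N).+1%:R = W ^+ 2 * (8 * s ^+ 2) / L ^+ 4.
    by rewrite /e /W; field; rewrite gt_eqF.
  by rewrite ler_pdivrMr // exprn_gt0.
have G_ge : 8 / 5 <= complex.Re
    (\sum_(0 <= j < (2 * N).+1) \sum_(0 <= k < (2 * N).+1) G j k).
  have -> : \sum_(0 <= j < (2 * N).+1) \sum_(0 <= k < (2 * N).+1) G j k =
    \sum_(0 <= a < (2 * m).+1) \sum_(0 <= b < (2 * m).+1)
      cell_sum s (P (j1 + a) (k1 + b))%N z.
    rewrite -(sum_window (fun j => \sum_(0 <= b < (2 * m).+1)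
      cell_sum s (P j (k1 + b))%N z) j1N).
    apply: eq_bigr => j _.
    rewrite -(sum_window (fun k => cell_sum s (P j k) z) k1N).
    rewrite /G /box; case: (_ && _)%N => //=.
    by rewrite big1.
  have Re_sum (I : Type) (r : seq I) (F : I -> R[i]) :
      complex.Re (\sum_(i <- r) F i) = \sum_(i <- r) complex.Re (F i).
    by apply: (big_morph _ _ _) => // -[? ?] [].
  rewrite Re_sum.
  apply: le_trans (box_sum_ge s0 m0 (x := 2 * s * (j1%:R - N%:R) - complex.Re z)
    (y := 2 * s * (k1%:R - N%:R) - complex.Im z) _ _) _ => //.
  rewrite le_eqVlt; apply/orP; left; apply/eqP.
  apply: eq_big_nat => a /andP[_ am]; rewrite Re_sum.
  apply: eq_big_nat => b /andP[_ bm].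
  rewrite Re_cell_sum; last first.
    apply: nz.
      by apply: P_grid; [apply: leq_trans j1N|apply: leq_trans k1N];
        rewrite ltn_add2l.
    by apply: boxD; rewrite /box !leq_addr !ltn_add2l am bm.
  rewrite /= Re_P Im_P !natrD.
  have shift (u v w t : R) : 2 * s * (u + v - w) - t = 2 * s * (u - w) - t + 2 * s * v.
    by ring.
  by rewrite !shift.
set g := (X in complex.Re X) in G_ge *; set h := (X in rnorm X <= _) in H_le *.
rewrite (le_trans _ (rnorm_geB _ _)) //.
have := rnorm_Re g; have := ler_norm (complex.Re g); lra.
Qed.
End Grid.

(** * Complex polynomials: generic shifts and limits *)

Section Poly.
Context {R : realType}.
Implicit Types (p q P Q : {poly R[i]}) (z w : R[i]) (t : R).

Lemma exists_notin_seq (T : eqType) (f : nat -> T) (r : seq T) :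
  injective f -> exists n, f n \notin r.
Proof.
move=> f_inj; apply: contrapT => /forallNP fr.
have : (size [seq f n | n <- iota 0 (size r).+1] <= size r)%N.
  apply: uniq_leq_size; first by rewrite map_inj_uniq ?iota_uniq.
  by move=> _ /mapP[n _ ->]; have /negP := fr n; rewrite negbK.
by rewrite size_map size_iota ltnn.
Qed.

Lemma small_real_notin (r : seq R[i]) t : 0 < t ->
  exists2 u : R, 0 < u <= t & u%:C%C \notin r.
Proof.
move=> t0; have [|n fr] := @exists_notin_seq _ (fun n => (t / n.+1%:R)%:C%C) r.
  move=> m n /complexI/(mulfI (lt0r_neq0 t0))/invr_inj/eqP.
  by rewrite eqr_nat => /eqP[].
exists (t / n.+1%:R) => //.
by rewrite divr_gt0 ?ltr0n //= ler_pdivrMr ?ltr0n // ler_peMr ?ler1n // ltW.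
Qed.

Lemma exists_roots p : p != 0 -> exists r : seq R[i], forall z, root p z -> z \in r.
Proof.
move=> p0; have [r pE] := closed_field_poly_normal p; exists r => z.
by rewrite pE rootZ ?lead_coef_eq0 // root_prod_XsubC.
Qed.

Lemma deriv_eq0_size p : p^`() = 0 -> (size p <= 1)%N.
Proof.
move=> p'0; rewrite leqNgt; apply/negP => p_gt1.
have : p^`()`_(size p).-2 = 0 by rewrite p'0 coef0.
rewrite coef_deriv; case E : (size p) p_gt1 => [|[|n]] //= _.
move/eqP; rewrite mulrn_eq0 /= => lc0.
have : lead_coef p == 0 by rewrite lead_coefE E.
by rewrite lead_coef_eq0 -size_poly_eq0 E.
Qed.

(** If the Wronskian vanished, [q] would divide [q^`()] by coprimality, so both
    derivatives would be 0, and [p] would be constant. *)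
Lemma wronskian_neq0 p q : coprimep p q -> q != 0 -> (1 < size p)%N ->
  p^`() * q - p * q^`() != 0.
Proof.
move=> pq q0 p_gt1; apply/eqP => /eqP; rewrite subr_eq0 => /eqP E.
have : q %| p * q^`() by rewrite -E dvdp_mull.
rewrite Gauss_dvdpr 1?coprimep_sym // => qq'.
have q'0 : q^`() = 0.
  apply/eqP/contraT => q'0; have := dvdp_leq q'0 qq'.
  by rewrite leqNgt lt_size_deriv.
move: E; rewrite q'0 mulr0 => /eqP; rewrite mulf_eq0 (negPf q0) orbF => /eqP.
by move=> /deriv_eq0_size; rewrite leqNgt p_gt1.
Qed.

Lemma simple_roots_deriv p : (forall z, root p z -> ~~ root p^`() z) ->
  simple_roots p.
Proof.
move=> pp' z pz.
have p0 : p != 0.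
  by apply/eqP => p0; have := pp' 0; rewrite p0 deriv0 root0 => /(_ isT).
apply/eqP; rewrite eqn_leq; apply/andP; split; last first.
  by rewrite mup_geq // expr1 dvdp_XsubCl.
rewrite leqNgt mup_geq //; apply: contra (pp' z pz) => /dvdpP[g ->].
rewrite expr2 !derivM /root !(hornerD, hornerM, hornerN, hornerX, hornerC) subrr.
by rewrite !(mulr0, mul0r, addr0).
Qed.

(** At a double root of [p + u q] the Wronskian of [p] and [q] vanishes, and
    [u] equals [- p / q] there; so only finitely many [u] are excluded. *)
Lemma generic_shift_simple p q t : coprimep p q -> q != 0 -> (1 < size p)%N ->
  0 < t -> exists2 u : R, 0 < u <= t & simple_roots (p + u%:C%C *: q).
Proof.
move=> pq q0 p_gt1 t0; have [r rW] := exists_roots (wronskian_neq0 pq q0 p_gt1).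
have [u ut ur] := small_real_notin [seq - p.[z] / q.[z] | z <- r] t0.
exists u => //; apply: simple_roots_deriv => z.
rewrite derivD derivZ /root !hornerE => /eqP pz; apply: contra ur => /eqP p'z.
have qz : q.[z] != 0.
  apply/eqP => qz; move: pz; rewrite qz mulr0 addr0 => /eqP pz.
  by have := coprimep_root pq pz; rewrite qz eqxx.
have pzE : p.[z] = - (u%:C%C * q.[z]) by apply/eqP; rewrite -addr_eq0 pz.
have p'zE : p^`().[z] = - (u%:C%C * q^`().[z]) by apply/eqP; rewrite -addr_eq0 p'z.
apply/mapP; exists z; last by rewrite pzE opprK mulfK.
by apply: rW; rewrite /root !hornerE pzE p'zE; apply/eqP; ring.
Qed.

Lemma horner_lipschitz p z : exists2 C : R, 0 < C & forall w,
  rnorm (w - z) <= 1 -> rnorm (p.[w] - p.[z]) <= C * rnorm (w - z).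
Proof.
have bound (g : {poly R[i]}) : exists2 C : R, 0 < C & forall w,
    rnorm (w - z) <= 1 -> rnorm g.[w] <= C.
  elim/poly_ind: g => [|g c [C C0 gC]].
    by exists 1 => // w _; rewrite horner0 rnorm0.
  exists (C * (rnorm z + 1) + rnorm c).
    by rewrite ltr_wpDr ?rnorm_ge0 // mulr_gt0 // ltr_wpDl ?rnorm_ge0.
  move=> w wz; rewrite hornerMXaddC (le_trans (rnormD _ _)) // lerD2r rnormM.
  rewrite ler_pM ?rnorm_ge0 ?gC // -(subrK z w) addrC (le_trans (rnormD _ _)) //.
  by rewrite lerD2l.
have /factor_theorem[g pE] : root (p - p.[z]%:P) z by rewrite /root !hornerE subrr.
have [C C0 gC] := bound g; exists C => // w wz.
have -> : p.[w] - p.[z] = g.[w] * (w - z).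
  by have := congr1 (horner^~ w) pE; rewrite /= hornerM hornerXsubC !hornerE.
by rewrite rnormM ler_wpM2r ?rnorm_ge0 ?gC.
Qed.

(** The inequality extends by continuity to the finitely many roots of [Q],
    which will be the removable singularities of a fraction. *)
Lemma horner_le_limit p q Q z (e : R) : Q != 0 -> 0 < e ->
  (forall w, rnorm (w - z) <= e -> ~~ root Q w -> rnorm q.[w] <= rnorm p.[w]) ->
  rnorm q.[z] <= rnorm p.[z].
Proof.
move=> Q0 e0 qp; rewrite leNgt; apply/negP => pq.
have [C C0 pC] := horner_lipschitz p z; have [D D0 qD] := horner_lipschitz q z.
pose g := rnorm q.[z] - rnorm p.[z].
have g0 : 0 < g by rewrite subr_gt0.
have [r rQ] := exists_roots Q0.
pose t := Num.min e (Num.min 1 (g / (2 * (C + D)))).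
have t0 : 0 < t by rewrite !lt_min e0 ltr01 /= divr_gt0 // mulr_gt0 // addr_gt0.
have [u /andP[u0 ut] ur] := small_real_notin [seq w - z | w <- r] t0.
move: ut; rewrite !le_min => /and3P[ue u1 ug].
pose w := z + u%:C%C.
have wz : w - z = u%:C%C by rewrite /w addrC addKr.
have nwz : rnorm (w - z) = u by rewrite wz rnormC gtr0_norm.
have Qw : ~~ root Q w.
  by apply: contra ur => /rQ wr; apply/mapP; exists w.
have := qp w; rewrite nwz => /(_ ue Qw) le_qp.
have := pC w; rewrite nwz => /(_ u1) le_p; have := qD w; rewrite nwz => /(_ u1) le_q.
have p1 : rnorm p.[w] <= rnorm (p.[w] - p.[z]) + rnorm p.[z].
  by rewrite -{1}(subrK p.[z] p.[w]) rnormD.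
have q1 : rnorm q.[z] <= rnorm (q.[w] - q.[z]) + rnorm q.[w].
  by rewrite rnormB -{1}(subrK q.[w] q.[z]) rnormD.
have : u * (2 * (C + D)) <= g by rewrite -ler_pdivlMr // mulr_gt0 // addr_gt0.
have : 0 < u * (C + D) by rewrite mulr_gt0 // addr_gt0.
by rewrite /g in g0 *; lra.
Qed.
End Poly.

(** * Operator bounds for fractions *)

Section Ratio.
Context {R : realType} {X : completeNormedModType R[i]}.
Variable A : X -> X.
Hypothesis A_bounded : bounded_operator A.
Implicit Types (x y : X) (z w c : R[i]) (p q P Q d : {poly R[i]}) (a b s B : R).

Let A_lin : linear A := A_bounded.1.

(** The bound [b] for the norm of [p(A) q(A)^-1], stated without the inverse:
    in this form it survives the addition of fractions and the cancellation of
    common factors. *)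
Definition ratio_le b p q : Prop :=
  forall x, rnorm (polyop A p x) <= b * rnorm (polyop A q x).

Lemma ratio_leD a b p P q Q : ratio_le a p q -> ratio_le b P Q ->
  ratio_le (a + b) (p * Q + q * P) (q * Q).
Proof.
move=> pq PQ x; rewrite polyopD (le_trans (rnormD _ _)) // mulrDl lerD //.
  by rewrite !polyopM.
by rewrite [q * P]mulrC [q * Q]mulrC !polyopM // polyopMC // polyopMC.
Qed.

Lemma ratio_le_cancel b p q d S : inverse_operator (polyop A d) S ->
  ratio_le b (p * d) (q * d) -> ratio_le b p q.
Proof.
move=> [_ _ dS] pq x; have := pq (S x).
by rewrite !polyopM // dS.
Qed.

Lemma ratio_le_opnorm b p q S : inverse_operator (polyop A q) S -> 0 <= b ->
  ratio_le b p q -> (opnorm (polyop A p \o S) <= b%:E)%E.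
Proof.
move=> [_ _ qS] b0 pq; apply: ub_ereal_sup => _ [x /= x1 <-].
rewrite lee_fin -[complex.Re _]/(rnorm _) (le_trans (pq _)) // qS ler_piMr //.
by rewrite -lecR -rnormE.
Qed.

(** Numerator and denominator of [cell_sum s c] as a rational function. *)
Definition cell_num s : {poly R[i]} := (4 * s%:C%C ^+ 4)%:P.
Definition cell_den s c : {poly R[i]} := (s%:C%C ^+ 4)%:P - ('X - c%:P) ^+ 4.

Lemma cell_den_horner s c z : (cell_den s c).[z] = s%:C%C ^+ 4 - (c - z) ^+ 4.
Proof. by rewrite /cell_den !hornerE; ring. Qed.

Lemma size_cell_den s c : size (cell_den s c) = 5.
Proof.
rewrite /cell_den addrC size_polyDl size_polyN size_exp_XsubC //.
by rewrite size_polyC; case: (_ != 0).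
Qed.

Lemma cell_den_neq0 s c : cell_den s c != 0.
Proof. by rewrite -size_poly_eq0 size_cell_den. Qed.

Lemma polyop_exp_lower B p n : 0 < B ->
  (forall x, rnorm x <= B * rnorm (polyop A p x)) ->
  forall x, rnorm x <= B ^+ n * rnorm (polyop A (p ^+ n) x).
Proof.
move=> B0 pB; elim: n => [|n IHn] x.
  by rewrite !expr0 polyopC // scale1r mul1r.
rewrite (le_trans (pB x)) // exprS -mulrA ler_pM2l // exprSr polyopM //.
Qed.

(** From the lower bound of [A - c] by [B^-1] follows that of its fourth power
    by [B ^- 4], and subtracting [s ^+ 4], which is at most half of this,
    leaves [B ^- 4 / 2]. *)
Lemma cell_ratio s B c : 0 <= s -> 0 < B -> s ^+ 4 * B ^+ 4 <= 1 / 2 ->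
  (forall x, rnorm x <= B * rnorm (A x - c *: x)) ->
  ratio_le (8 * s ^+ 4 * B ^+ 4) (cell_num s) (cell_den s c).
Proof.
move=> s0 B0 sB cB x.
have xB : rnorm x <= B ^+ 4 * rnorm (polyop A (('X - c%:P) ^+ 4) x).
  by apply: polyop_exp_lower => // y; rewrite polyop_shift.
rewrite /cell_num /cell_den -scaleN1r polyopD !polyopC polyopZ scaleN1r rnormZ rnormM.
rewrite (rnorm_nat 4).
have sn : rnorm (s%:C%C ^+ 4) = s ^+ 4 by rewrite rnormX rnormC ger0_norm.
rewrite sn; move: xB; set y := polyop A _ x => xB.
have := rnorm_geB y (- (s%:C%C ^+ 4 *: x)).
rewrite rnormN rnormZ sn rnormB => yx.
have B4 : 0 < B ^+ 4 by rewrite exprn_gt0.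
have s4 : 0 <= s ^+ 4 by rewrite exprn_ge0.
move: yx; set t := rnorm (_ - y) => yx.
have := ler_wpM2l (ltW B4) yx; rewrite mulrBr mulrA [B ^+ 4 * s ^+ 4]mulrC => Byx.
have sBx := ler_wpM2r (rnorm_ge0 x) sB.
have xt : rnorm x <= 2 * (B ^+ 4 * t) by lra.
have := ler_wpM2l s4 xt; lra.
Qed.

(** The sum of the fractions of the cells, over the product of all their
    denominators and not yet in lowest terms. *)
Lemma cells_fraction s b (S : seq R[i]) :
  (forall c, c \in S -> ratio_le b (cell_num s) (cell_den s c)) ->
  let Q := \prod_(c <- S) cell_den s c in
  exists P, [/\ (size P < size Q)%N, ratio_le ((size S)%:R * b) P Q
   & forall z, ~~ root Q z -> P.[z] / Q.[z] = \sum_(c <- S) cell_sum s c z].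
Proof.
elim: S => [|c S IHS] cS /=.
  exists 0; rewrite big_nil size_poly0 size_poly1; split=> // [x|z _].
    by rewrite polyopC // scale0r rnorm0 mul0r mul0r.
  by rewrite big_nil horner0 mul0r.
have [|P [PQ PQb PQz]] := IHS.
  by move=> c' c'S; apply: cS; rewrite in_cons c'S orbT.
set Q := \prod_(c <- S) _ in PQ PQb PQz.
rewrite big_cons -/Q; exists (cell_num s * Q + cell_den s c * P).
have Q0 : Q != 0 by rewrite -size_poly_gt0 (leq_ltn_trans _ PQ).
have Q_gt0 : (0 < size Q)%N by rewrite size_poly_gt0.
split.
- rewrite size_mul ?cell_den_neq0 // size_cell_den.
  rewrite (leq_ltn_trans (size_polyD _ _)) // gtn_max; apply/andP; split.
    rewrite /cell_num mul_polyC (leq_ltn_trans (size_scale_leq _ _)) //.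
    by rewrite !addSn /= ltnS leqW // leqW // leqW.
  rewrite (leq_ltn_trans (size_polyMleq _ _)) // size_cell_den.
  by rewrite !addSn !add0n /= !ltnS.
- have -> : (size (c :: S))%:R * b = b + (size S)%:R * b :> R.
    by rewrite /= -nat1r mulrDl mul1r.
  by apply: ratio_leD => //; apply: cS; rewrite mem_head.
- move=> z; rewrite rootM negb_or => /andP[cz Qz].
  rewrite big_cons -PQz // hornerD 3!hornerM cell_den_horner /cell_num hornerC.
  move: cz Qz; rewrite /root cell_den_horner => cz Qz.
  by rewrite /cell_sum; field; rewrite cz Qz.
Qed.

Lemma root_prod_cell_den s (S : seq R[i]) z :
  root (\prod_(c <- S) cell_den s c) z = has (fun c => root (cell_den s c) z) S.
Proof.
elim: S => [|c S IHS]; first by rewrite big_nil (negPf (root1 z)).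
by rewrite big_cons rootM IHS.
Qed.

Lemma root_cell_den s c z : 0 <= s -> root (cell_den s c) z -> rnorm (c - z) = s.
Proof.
move=> s0; rewrite /root cell_den_horner subr_eq0 => /eqP/(congr1 rnorm)/eqP.
rewrite !rnormX rnormC ger0_norm // eqrXn2 ?rnorm_ge0 // => /eqP//.
Qed.
End Ratio.

(** * The region Gamma *)

Section Gamma.
Context {R : realType}.
Implicit Types (K : set R[i]) (z w : R[i]) (e : R).

Lemma Gamma_near K e z : 0 < e -> Gamma K e z ->
  exists2 w, K w & rnorm (z - w) < e + 1.
Proof.
move=> e0 [zK _].
have : (dist_to K z < (e + 1)%:E)%E.
  by rewrite (le_lt_trans zK) // lte_fin ltrDl.
by move=> /ereal_inf_lt[_ [w Kw <-]]; rewrite lte_fin; exists w.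
Qed.

(** Otherwise the triangle inequality puts a whole disc around [z] inside the
    thickening by [e / 2]. *)
Lemma Gamma_far K e z : Gamma K e z -> forall w, K w -> e / 2 <= rnorm (z - w).
Proof.
move=> [_ zK] w Kw; rewrite leNgt; apply: contra_notN zK => zw.
pose t := e / 2 - rnorm (z - w).
have t0 : 0 < t by rewrite subr_gt0.
have t0' : 0 < t%:C%C by rewrite -[0]/(0%:C%C) ltcR.
apply/nbhs_ballP; exists t%:C%C => // y.
rewrite -ball_normE /ball_ /= rnormE ltcR => zy.
apply: (@le_trans _ _ (rnorm (y - w))%:E); first by apply: ereal_inf_lbound; exists w.
rewrite lee_fin.
have -> : y - w = (y - z) + (z - w) by rewrite addrA subrK.
by rewrite (le_trans (rnormD _ _)) // rnormB -lerBrDr ltW.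
Qed.
End Gamma.

(** * A fraction separating the spectrum from its surroundings *)

Section SeparatingFraction.
Context {R : realType} {X : completeNormedModType R[i]}.
Variable A : X -> X.
Hypothesis A_bounded : bounded_operator A.
Let A_lin : linear A := A_bounded.1.
Implicit Types (x y : X) (z w c : R[i]) (p q P Q d : {poly R[i]}) (e s B r L W : R).

(** A mesh [s], an odd fraction of [L], that meets the smallness conditions of
    [cell_ratio] and [grid_sum_ge], and for which the operator bounds of
    [(W / s) ^+ 2] cells add up to at most [1 / 8]. *)
Lemma exists_mesh L W B : 0 < L -> 0 < W -> 0 < B ->
  exists2 m, (0 < m)%N & let s := L / (2 * m).+1%:R in
  [/\ s ^+ 4 * B ^+ 4 <= 1 / 2, W ^+ 2 * (8 * s ^+ 2) * B ^+ 4 <= 1 / 8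
    & W ^+ 2 * (8 * s ^+ 2) <= 3 / 5 * L ^+ 4].
Proof.
move=> L0 W0 B0.
pose b := B ^+ 4; pose u := W ^+ 2; pose l := L ^+ 4.
have b0 : 0 < b by rewrite exprn_gt0.
have u0 : 0 < u by rewrite exprn_gt0.
have l0 : 0 < l by rewrite exprn_gt0.
(* [s * C <= 1] implies the three conditions, and [s <= 1], termwise. *)
pose C := 1 + 2 * b + 64 * u * b + 40 * u / (3 * l).
have ub : 0 < 64 * u * b by rewrite mulr_gt0 // mulr_gt0.
have ul : 0 < 40 * u / (3 * l) by rewrite divr_gt0 // mulr_gt0.
have C1 : 1 < C by rewrite /C; lra.
pose m := Num.bound (L * C); exists m.+1 => // s.
have s_gt0 : 0 < s by rewrite divr_gt0 // ltr0n.
have sC : s * C <= 1.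
  rewrite /s mulrAC ler_pdivrMr ?ltr0n // mul1r natr_odd -[m.+1%:R]natr1.
  have := archi_boundP (ltW (mulr_gt0 L0 (lt_trans ltr01 C1))).
  rewrite -/m => LCm; have m0 : 0 <= m%:R :> R by []. 
  by lra.
have s1 : s <= 1 by nra.
have ss : s ^+ 2 <= s by nra.
have s4 : s ^+ 4 <= s.
  have -> : s ^+ 4 = s ^+ 2 * s ^+ 2 by ring.
  by nra.
have sCE : s * C = s + 2 * (s * b) + 64 * (s * u * b) + s * (40 * u / (3 * l)).
  by rewrite /C; ring.
have sb : 0 < s * b by rewrite mulr_gt0.
have sub : 0 < s * u * b by rewrite mulr_gt0 // mulr_gt0.
have sul : 0 < s * (40 * u / (3 * l)) by rewrite mulr_gt0.
rewrite -/b -/u -/l; split.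
- by have := ler_wpM2r (ltW b0) s4; lra.
- have := ler_wpM2r (ltW b0) (ler_wpM2l (ltW u0) ss); lra.
- have : s * (40 * u / (3 * l)) <= 1 by lra.
  rewrite mulrA ler_pdivrMr ?mulr_gt0 // => h.
  by have := ler_wpM2l (ltW u0) ss; lra.
Qed.

(** The fraction is the sum of [cell_sum] over the cells whose centre is at
    distance at least [e / 4] from the spectrum. On these centres the resolvent
    is uniformly bounded, so the operator bound follows from [cell_ratio]; a
    point at distance at least [3 / 8 * e] is surrounded by a box of such cells
    of half-width [e / 16], so the lower bound is [grid_sum_ge]. *)
Lemma separating_fraction e r : 0 < e -> 0 < r ->
  exists P Q, [/\ Q != 0, (size P < size Q)%N,
    forall z, spectrum A z -> ~~ root Q z,
    ratio_le A (1 / 8) P Q &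
    forall z, rnorm z <= r ->
      (forall w, spectrum A w -> 3 / 8 * e <= rnorm (z - w)) ->
      ~~ root Q z -> rnorm Q.[z] <= rnorm P.[z]].
Proof.
move=> e0 r0.
pose L := e / 16; have L0 : 0 < L by rewrite divr_gt0.
have [k rk] : exists k, r + L <= L * (2 * k).+1%:R.
  exists (Num.bound (r / L)); rewrite natr_odd.
  have := archi_boundP (ltW (divr_gt0 r0 L0)); rewrite ltr_pdivrMr //.
  by have := divr_gt0 r0 L0; set t := _%:R => h1 h2; nra.
pose W := L * (2 * k).+1%:R; have W0 : 0 < W by rewrite mulr_gt0 // ltr0n.
have [B B0 AB] := @uniform_resolvent _ _ A W (e / 4) (divr_gt0 e0 (ltr0n _ 4)).
have [m m0] := exists_mesh L0 W0 B0; set s := L / _ => -[sB sWB sW].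
have s0 : 0 < s by rewrite divr_gt0 // ltr0n.
(* With this [N] the grid has [(2 * m).+1 * (2 * k).+1] cells per side, so that
   it fills the square of half-width [W] exactly. *)
pose N := (2 * k * m + k + m)%N.
have mN : (m <= N)%N by rewrite leq_addl.
have LE : s * (2 * m).+1%:R = L by rewrite /s mulfVK // pnatr_eq0.
have WE : s * (2 * N).+1%:R = W.
  have -> : (2 * N).+1 = ((2 * m).+1 * (2 * k).+1)%N by rewrite /N; nia.
  by rewrite natrM mulrA LE.
have s3 : 3 * s <= L.
  have m1 : 1 <= m%:R :> R by rewrite ler1n.
  by rewrite -LE natr_odd; nra.
pose D : pred R[i] := fun c => `[< forall w, spectrum A w -> e / 4 <= rnorm (c - w) >].
pose S := [seq c <- grid s N | D c].
have SB c : c \in S -> ratio_le A (8 * s ^+ 4 * B ^+ 4) (cell_num s) (cell_den s c).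
  rewrite mem_filter => /andP[/asboolP Dc /(grid_abs_le (ltW s0))]; rewrite WE => -[c1 c2].
  by apply: cell_ratio => //; [exact: ltW|move=> x; exact: AB].
have [P []] := cells_fraction A_bounded SB; set Q := \prod_(c <- S) _ => PQ PQb PQz.
have Q0 : Q != 0 by rewrite -size_poly_gt0 (leq_ltn_trans _ PQ).
exists P, Q; split=> //.
- move=> z Kz; apply/negP; rewrite root_prod_cell_den => /hasP[c cS].
  (* A pole is at distance [s] from the centre of its cell, and [s] is smaller
     than the distance [e / 4] of this centre from the spectrum. *)
  move=> /(root_cell_den (ltW s0)) cz.
  move: cS; rewrite mem_filter => /andP[/asboolP/(_ _ Kz)].
  by rewrite cz /L in s3 *; lra.
- move=> x; rewrite (le_trans (PQb x)) // ler_wpM2r ?rnorm_ge0 //.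
  apply: le_trans sWB; rewrite -WE.
  have -> : (s * (2 * N).+1%:R) ^+ 2 * (8 * s ^+ 2) * B ^+ 4
     = ((2 * N).+1 ^ 2)%:R * (8 * s ^+ 4 * B ^+ 4) by rewrite natrX; ring.
  rewrite ler_pM2r; last by rewrite !mulr_gt0 ?exprn_gt0.
  by rewrite ler_nat -(size_grid s N) size_filter count_size.
- move=> z zr zK Qz.
  have Qz0 : 0 < rnorm Q.[z] by rewrite rnorm_gt0.
  rewrite -[leLHS]mul1r -ler_pdivlMr // -rnormV -rnormM PQz // /S big_filter.
  have WL : r <= W - L by rewrite /W; lra.
  apply: (@grid_sum_ge _ s m N) => //; rewrite ?LE ?WE //.
  + exact: le_trans (rnorm_Re z) (le_trans zr WL).
  + exact: le_trans (rnorm_Im z) (le_trans zr WL).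
  + move=> c c1 c2; apply/asboolP => w /zK zw.
    have cz : rnorm (c - z) <= 2 * L by rewrite (le_trans (rnorm_le_ReIm _)) //; lra.
    have := rnorm_geB (z - w) (c - z).
    have -> : z - w + (c - z) = c - w by rewrite addrC addrA subrK.
    by rewrite /L in cz; lra.
  + move=> c cg Dc; apply: contraNneq Qz => cz.
    rewrite root_prod_cell_den; apply/hasP; exists c.
      by rewrite mem_filter Dc.
    by rewrite /root cell_den_horner cz.
Qed.

(** Cancelling the common factor fills the removable singularities left by the
    cancellation along shared edges. There the lower bound holds by
    continuity, for which the distance [3 / 8 * e] of [separating_fraction]
    leaves room below [e / 2]. *)
Lemma separating_reduced_fraction e r : 0 < e -> 0 < r ->
  exists p q, [/\ coprimep p q, q != 0, (size p < size q)%N,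
    forall z, spectrum A z -> ~~ root q z &
    ratio_le A (1 / 8) p q /\
    forall z, rnorm z <= r ->
      (forall w, spectrum A w -> e / 2 <= rnorm (z - w)) ->
      rnorm q.[z] <= rnorm p.[z]].
Proof.
move=> e0 r0; have [P [Q [Q0 PQ QK PQb PQz]]] := separating_fraction e0 (ltr_wpDr ler01 r0).
set d := gcdp P Q; pose p := P %/ d; pose q := Q %/ d.
have PE : P = p * d by rewrite divpK // dvdp_gcdl.
have QE : Q = q * d by rewrite divpK // dvdp_gcdr.
have d0 : d != 0 by rewrite gcdp_eq0 negb_and Q0 orbT.
have q0 : q != 0 by apply: contraNneq Q0 => q0; rewrite QE q0 mul0r.
have dK z : spectrum A z -> ~~ root d z.
  by move=> /QK; rewrite QE rootM negb_or => /andP[].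
exists p, q; split=> //.
- by rewrite coprimep_div_gcd // Q0 orbT.
- have [->|p0] := eqVneq p 0; first by rewrite size_poly0 size_poly_gt0.
  move: PQ; rewrite PE QE !size_mul // -!subn1 ltn_sub2rE ?ltn_add2r //.
  by rewrite addn_gt0 size_poly_gt0 p0.
- by move=> z /QK; rewrite QE rootM negb_or => /andP[].
split.
  have [S dS] := polyop_invertible A_bounded d0 dK.
  apply: (ratio_le_cancel A_bounded dS).
  by rewrite -PE -QE.
move=> z zr zK; pose t := Num.min 1 (e / 8).
have t0 : 0 < t by rewrite lt_min ltr01 divr_gt0.
apply: (horner_le_limit Q0 t0) => w; rewrite le_min => /andP[wz1 wze] Qw.
have dw : 0 < rnorm d.[w].
  by rewrite rnorm_gt0; apply: contra Qw; rewrite QE rootM /root => ->; rewrite orbT.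
rewrite -(ler_pM2r dw) -!rnormM -!hornerM -PE -QE PQz //.
  by rewrite -(subrK z w) (le_trans (rnormD _ _)) // addrC lerD.
move=> v /zK zv; have := rnorm_geB (z - v) (w - z).
have -> : z - v + (w - z) = w - v by rewrite addrC addrA subrK.
by lra.
Qed.
End SeparatingFraction.

Theorem corollary2p2 (R : realType) (X : completeNormedModType R[i])
    (A : X -> X) (eps : R) (A_bounded : bounded_operator A)
    (eps_gt0 : 0 < eps) :
  exists p q : {poly R[i]},
    [/\ reduced_fraction p q,
        forall z, spectrum A z -> ~~ root q z,
        (size q < size p)%N,
        simple_roots p &
        (exists2 rA : X -> X, is_ratop A p q rA & (opnorm rA < 1)%E) /\
        (forall z, Gamma (spectrum A) eps z -> (1 < abs_rat p q z)%E)].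
Proof.
have A_lin : linear A := A_bounded.1.
have [M M0 AM] := bounded_rnorm A_bounded.2.
pose r := M + eps + 1.
have r0 : 0 < r by rewrite /r; lra.
have [p [q [pq q0 sz qK [pqb pqz]]]] := separating_reduced_fraction A_bounded eps_gt0 r0.
(* On the disc of radius [r], which contains both the spectrum and Gamma, the
   term [delta * z] has modulus at most [1 / 4], and [delta * A] has norm at
   most [1 / 4]. *)
pose delta := (4 * r)^-1.
have delta0 : 0 < delta by rewrite invr_gt0 mulr_gt0.
pose f := delta%:C%C *: 'X.
pose p1 := f * q + 2 *: p.
have f0 : delta%:C%C != 0 by rewrite (inj_eq (@complexI R)) gt_eqF.
have p1q : coprimep p1 q.
  by rewrite /p1 coprimep_sym coprimep_addl_mul coprimepZr ?pnatr_eq0 // coprimep_sym.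
have size_fq : size (f * q) = (size q).+1.
  by rewrite -scalerAl size_scale // mulrC size_mulX.
have size_p1 : size p1 = (size q).+1.
  by rewrite size_polyDl // size_fq ltnS (leq_trans (size_scale_leq _ _)) // ltnW.
have p1_gt1 : (1 < size p1)%N by rewrite size_p1 ltnS size_poly_gt0.
have [u /andP[u0 u4] simple] :=
  generic_shift_simple p1q q0 p1_gt1 (divr_gt0 ltr01 (ltr0n R 4)).
pose p2 := p1 + u%:C%C *: q.
have p2E z : p2.[z] = 2 * p.[z] + (delta%:C%C * z + u%:C%C) * q.[z].
  by rewrite /p2 /p1 /f !hornerE; ring.
exists p2, q; split=> //.
- split=> // z [p2z qz]; move: p2z; rewrite /root p2E (rootP qz) mulr0 addr0.
  rewrite mulf_eq0 pnatr_eq0 /= => pz.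
  by have := coprimep_root pq pz; rewrite (rootP qz) eqxx.
- by rewrite size_polyDl size_p1 // ltnS size_scale_leq.
split.
  have [S qS] := polyop_invertible A_bounded q0 qK.
  exists (polyop A p2 \o S); first by exists S.
  (* Here [1 / 4] is twice the bound [1 / 8] of the separating fraction; the
     other two terms are at most [1 / 4] each. *)
  pose b := 1 / 4 + delta * M + u.
  have p2b : ratio_le A b p2 q.
    move=> x; rewrite /p2 /p1 /f !polyopD -scalerAl !polyopZ.
    rewrite polyopM // polyopX; set y := polyop A q x.
    rewrite (le_trans (rnormD _ _)) // (le_trans (lerD (rnormD _ _) (lexx _))) //.
    rewrite !rnormZ !rnormC (rnorm_nat 2) !gtr0_norm //.
    have := ler_wpM2l (ltW delta0) (AM y); have := pqb x; rewrite -/y /b; lra.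
  have dM : delta * M <= 1 / 4.
    by rewrite mulrC ler_pdivrMr ?mulr_gt0 // /r; lra.
  apply: le_lt_trans (ratio_le_opnorm qS _ p2b) _.
    by rewrite /b; have := mulr_gt0 delta0 M0; lra.
  by rewrite lte_fin /b; lra.
move=> z zG; rewrite /abs_rat; case: ifPn => [_|qz]; first by rewrite ltry.
have [w Kw zw] := Gamma_near eps_gt0 zG.
have zr : rnorm z <= r.
  rewrite -(subrK w z) (le_trans (rnormD _ _)) // /r.
  by have := spectrum_bounded A_bounded M0 AM Kw; lra.
have := pqz z zr (Gamma_far zG).
have qz0 : 0 < rnorm q.[z] by rewrite rnorm_gt0.
rewrite lte_fin -[complex.Re _]/(rnorm _) rnormM rnormV ltr_pdivlMr // mul1r p2E.
move=> le_qp; apply: lt_le_trans (rnorm_geB _ _).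
rewrite !rnormM (rnorm_nat 2); set h := rnorm (_ + _).
have : h <= 1 / 2.
  rewrite (le_trans (rnormD _ _)) // rnormM !rnormC !gtr0_norm //.
  have := ler_wpM2l (ltW delta0) zr.
  have -> : delta * r = 1 / 4 by rewrite /delta; field; rewrite gt_eqF.
  by lra.
by move=> /(ler_wpM2r (ltW qz0)); lra.
Qed.
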